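(* Let $m,n,c,d$ be positive integers with $n\le c\le m$, let $A\in\mathbb{R}^{m\times n}$ with $\operatorname{rank}(A)=n$, $B\in\mathbb{R}^{m\times d}$, and $S\in\mathbb{R}^{c\times m}$. Let $A=QR$ be a thin QR decomposition, where $Q\in\mathbb{R}^{m\times n}$ has orthonormal columns and $R\in\mathbb{R}^{n\times n}$ is nonsingular, and let $Q_\perp\in\mathbb{R}^{m\times(m-n)}$ be such that $(Q\;\;Q_\perp)$ is an orthogonal matrix. Put $\hat X=A^\dagger B$, $\hat R=B-A\hat X$, $\tilde X=(SA)^\dagger SB$, $\mathcal{Q}=\operatorname{range}(Q)$, and $\mathcal{S}=\operatorname{range}(S^T)$. If $S$ has orthonormal rows, then $$\|(SQ)^\dagger(SQ_\perp)\|_2=\tan\theta_1(\mathcal{S},\mathcal{Q}),$$ where $\theta_1(\mathcal{S},\mathcal{Q})$ denotes a largest principal angle between $\mathcal{S}$ and $\mathcal{Q}$. Moreover, for every $1\le p\le\infty$, $$\|\tilde X-\hat X\|_{(p)}\le\tan\theta_1(\mathcal{S},\mathcal{Q})\,\|A^\dagger\|_2\,\|\hat R\|_{(p)}.$$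
   Context: $M^\dagger$ denotes the Moore–Penrose inverse of $M$, and $\|M\|_2=\sigma_1(M)$ is the spectral (operator) norm. For a real matrix $M$ with singular values $\sigma_1(M)\ge\sigma_2(M)\ge\cdots\ge 0$, the Schatten $p$-norm is $\|M\|_{(p)}=\left(\sum_j\sigma_j(M)^p\right)^{1/p}$ for $1\le p<\infty$, and $\|M\|_{(\infty)}=\sigma_1(M)$. The principal angles between subspaces $\mathcal{U},\mathcal{V}\subseteq\mathbb{R}^m$ with orthonormal bases given by the columns of $U$ and $V$ are the $\min(\dim\mathcal{U},\dim\mathcal{V})$ numbers in $[0,\pi/2]$ whose cosines are the singular values of $U^TV$. The tangent of a principal angle is allowed to be $\infty$ (that is, $\tan(\pi/2)=\infty$). The matrix $\hat X$ is the minimal-norm solution of the exact problem $\min_{X\in\mathbb{R}^{n\times d}}\|AX-B\|_{(p)}$, with residual $\hat R$. The matrix $\tilde X$ is the minimal-norm solution of the perturbed (sketched) problem $\min_{X\in\mathbb{R}^{n\times d}}\|S(AX-B)\|_{(p)}$.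
   Formalization: The equality is asserted only when the tangent of the largest principal angle is finite (it fails when the angle is π/2), and the inequality only when its right-hand side is not the undefined product ∞·0 (infinite tangent with zero residual). *)

(* Defs.v *)
From mathcomp Require Import all_boot all_order all_algebra.
From mathcomp Require Import all_classical all_reals all_analysis.

Set Implicit Arguments.
Unset Strict Implicit.
Unset Printing Implicit Defensive.

Import Order.TTheory GRing.Theory Num.Theory.
Local Open Scope ring_scope.

Section Definitions.
Variable R : realType.

Definition orthonormal_cols m k (U : 'M[R]_(m, k)) : Prop := U^T *m U = 1%:M.

Definition orthonormal_rows k m (S : 'M[R]_(k, m)) : Prop := S *m S^T = 1%:M.

(* The two dimensions are separate variables so that this applies to block
   matrices such as row_mx Q Qp : 'M_(m, n + (m - n)), whose dimensions are equal
   but not convertible; the two conditions together force m = k. *)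
Definition orthogonal_mx m k (U : 'M[R]_(m, k)) : Prop :=
  orthonormal_cols U /\ orthonormal_rows U.

Definition thin_qr m n (A Q : 'M[R]_(m, n)) (T : 'M[R]_n) : Prop :=
  [/\ A = Q *m T, orthonormal_cols Q, is_trig_mx T^T & T \in unitmx].

(* The four Penrose equations.  The library's pinvmx is only a one-sided inverse
   on a row space, not the Moore-Penrose inverse. *)
Definition is_mpinv m n (M : 'M[R]_(m, n)) (X : 'M[R]_(n, m)) : Prop :=
  [/\ M *m X *m M = M, X *m M *m X = X,
      (M *m X)^T = M *m X & (X *m M)^T = X *m M].

(* The Moore-Penrose inverse exists and is unique for every real matrix, so the
   default value is never taken; likewise for singular_values and
   principal_angles below. *)
Definition mpinv m n (M : 'M[R]_(m, n)) : 'M[R]_(n, m) :=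
  xget 0 [set X | is_mpinv M X]%classic.

Definition rect_diag_mx m n (s : seq R) : 'M[R]_(m, n) :=
  \matrix_(i, j) (if i == j :> nat then s`_i else 0).

Definition is_singular_values m n (M : 'M[R]_(m, n)) (s : seq R) : Prop :=
  [/\ size s = minn m n, sorted >=%R s, all (>= 0) s &
      exists (U : 'M[R]_m) (V : 'M[R]_n),
        [/\ orthogonal_mx U, orthogonal_mx V &
            M = U *m rect_diag_mx m n s *m V^T]].

Definition singular_values m n (M : 'M[R]_(m, n)) : seq R :=
  xget [::] [set s | is_singular_values M s]%classic.

(* The largest singular value; 0 for a matrix with no row or no column. *)
Definition spectral_norm m n (M : 'M[R]_(m, n)) : R := (singular_values M)`_0.

(* Meaningful for 1 <= p <= +oo; the value at p = -oo is irrelevant. *)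
Definition schatten_norm (p : \bar R) m n (M : 'M[R]_(m, n)) : R :=
  match p with
  | EFin q => (\sum_(s <- singular_values M) s `^ q) `^ q^-1
  | +oo%E => spectral_norm M
  | -oo%E => 0
  end.

Definition col_range m n (M : 'M[R]_(m, n)) : {vspace 'cV[R]_m} :=
  limg (linfun (mulmx M : 'cV[R]_n -> 'cV[R]_m)).

Definition is_orthonormal_basis m k (W : {vspace 'cV[R]_m}) (U : 'M[R]_(m, k)) :
  Prop := orthonormal_cols U /\ col_range U = W.

(* The singular values of U^T V lie in [0, 1], so acos takes them to [0, pi/2];
   they do not depend on the choice of the two orthonormal bases. *)
Definition principal_angles m (W1 W2 : {vspace 'cV[R]_m}) : seq R :=
  xget [::] [set t | exists (U : 'M[R]_(m, \dim W1)) (V : 'M[R]_(m, \dim W2)),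
    [/\ is_orthonormal_basis W1 U, is_orthonormal_basis W2 V &
        t = map acos (singular_values (U^T *m V))]]%classic.

Definition largest_principal_angle m (W1 W2 : {vspace 'cV[R]_m}) : R :=
  \big[Num.max/0]_(t <- principal_angles W1 W2) t.

(* The tangent of an angle in [0, pi/2], with tan (pi/2) = +oo (the library's
   tan vanishes there). *)
Definition etan (t : R) : \bar R := if t == pi / 2 then +oo%E else (tan t)%:E.

End Definitions.

(* Main.v *)
(* A real singular value decomposition is built by induction: a maximizer [v] of
   [|Mx|] on the unit sphere and the normalized [Mv] are completed to orthogonal
   bases by reflections, and maximality forces [M] to be block diagonal in them.
   The comparison "[|Mx| <= a |Nx|] for all [x] implies [s_i(M) <= a s_i(N)]" then
   gives both the uniqueness of the singular values and the inequality between
   Schatten norms.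

   Let [N = SQ], with smallest singular value [s], the cosine of the largest angle.
   If [s > 0], then [S S^T = 1] gives [(S Qp)(S Qp)^T = 1 - N N^T], so that
   [K = N^+ S Qp] satisfies [K K^T = (N^T N)^-1 - 1] and
   [|K|^2 = 1 / s^2 - 1 = tan^2].  Finally [Xtilde - Xhat = T^-1 K Qp^T Rhat], where
   [|T^-1 x| <= |A^+| |x|].  If [s = 0], the right-hand side of the bound is infinite. *)
Require Import Defs.
From mathcomp Require Import all_boot all_order all_algebra.
From mathcomp Require Import all_classical all_reals all_analysis.
From mathcomp Require Import ring lra.

Set Implicit Arguments.
Unset Strict Implicit.
Unset Printing Implicit Defensive.

Import Order.TTheory GRing.Theory Num.Theory.
Import numFieldNormedType.Exports.
Local Open Scope ring_scope.

(** * Squared Euclidean norms, orthogonal matrices and reflections *)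

Definition sqnorm (R : realType) n (x : 'cV[R]_n) : R := \sum_i x i 0 ^+ 2.

Section SquaredNorm.
Variable R : realType.

Lemma sqnormE n (x : 'cV[R]_n) : sqnorm x = (x^T *m x) 0 0.
Proof. by rewrite mxE; apply: eq_bigr => i _; rewrite mxE expr2. Qed.

Lemma sqnorm_ge0 n (x : 'cV[R]_n) : 0 <= sqnorm x.
Proof. by apply: sumr_ge0 => i _; rewrite sqr_ge0. Qed.

Lemma sqnorm0 n : sqnorm (0 : 'cV[R]_n) = 0.
Proof. by rewrite /sqnorm big1 // => i _; rewrite mxE expr0n. Qed.

Lemma sqnorm_eq0 n (x : 'cV[R]_n) : (sqnorm x == 0) = (x == 0).
Proof.
apply/idP/idP => [|/eqP->]; last by rewrite sqnorm0.
rewrite psumr_eq0 => [/allP x0|i _]; last exact: sqr_ge0.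
apply/eqP/colP => i; rewrite mxE.
by have := x0 i (mem_index_enum i); rewrite sqrf_eq0 => /eqP.
Qed.

Lemma sqnorm_gt0 n (x : 'cV[R]_n) : (0 < sqnorm x) = (x != 0).
Proof. by rewrite lt0r sqnorm_eq0 sqnorm_ge0 andbT. Qed.

Lemma sqnormZ n a (x : 'cV[R]_n) : sqnorm (a *: x) = a ^+ 2 * sqnorm x.
Proof. by rewrite mulr_sumr; apply: eq_bigr => i _; rewrite mxE exprMn. Qed.

Lemma sqnorm_mulmx m n (U : 'M[R]_(m, n)) (x : 'cV[R]_n) :
  sqnorm (U *m x) = (x^T *m (U^T *m U) *m x) 0 0.
Proof. by rewrite sqnormE trmx_mul !mulmxA. Qed.

Lemma sqnorm_isometry m n (U : 'M[R]_(m, n)) (x : 'cV[R]_n) :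
  orthonormal_cols U -> sqnorm (U *m x) = sqnorm x.
Proof. by move=> UU; rewrite sqnorm_mulmx UU mulmx1 sqnormE. Qed.

(** Bessel's inequality: the difference of the two sides is the squared length of [x - U U^T x], the
    residual of the orthogonal projection onto the columns of [U]. *)
Lemma sqnorm_trmx_le m n (U : 'M[R]_(m, n)) (x : 'cV[R]_m) :
  orthonormal_cols U -> sqnorm (U^T *m x) <= sqnorm x.
Proof.
move=> UU; rewrite -subr_ge0.
suff -> : sqnorm x - sqnorm (U^T *m x) = sqnorm (x - U *m (U^T *m x)).
  exact: sqnorm_ge0.
have E a b : sqnorm (a - b) = sqnorm a - (a^T *m b) 0 0 - (b^T *m a) 0 0
    + sqnorm b :> R.
  rewrite !sqnormE [(a - b)^T]linearB /= mulmxBl !mulmxBr !mxE; ring.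
rewrite E (sqnorm_isometry _ UU) !trmx_mul trmxK [sqnorm (_ *m _)]sqnormE.
by rewrite trmx_mul trmxK !mulmxA; ring.
Qed.

Lemma sqnorm_col_mx m n (x : 'cV[R]_m) (y : 'cV[R]_n) :
  sqnorm (col_mx x y) = sqnorm x + sqnorm y.
Proof.
rewrite /sqnorm big_split_ord /=.
by congr (_ + _); apply: eq_bigr => i _; rewrite ?col_mxEu ?col_mxEd.
Qed.

Lemma sqnorm_scalar (a : R) : sqnorm (a%:M : 'cV[R]_1) = a ^+ 2.
Proof. by rewrite /sqnorm big_ord1 mxE eqxx. Qed.

Lemma sqnorm_delta n (i : 'I_n) : sqnorm (delta_mx i 0 : 'cV[R]_n) = 1.
Proof.
rewrite /sqnorm (bigD1 i) //= mxE !eqxx expr1n big1 ?addr0 // => j ji.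
by rewrite mxE (negbTE ji) expr0n.
Qed.

Lemma orthonormal_cols_orthogonal n (U : 'M[R]_n) :
  orthonormal_cols U -> orthogonal_mx U.
Proof. by move=> UU; split=> //; apply: mulmx1C. Qed.

Lemma orthogonal_mxT n (U : 'M[R]_n) : orthogonal_mx U -> orthogonal_mx U^T.
Proof.
by case=> UU UU'; split; rewrite /orthonormal_cols /orthonormal_rows trmxK.
Qed.

Lemma orthogonal_mxM n (U V : 'M[R]_n) :
  orthogonal_mx U -> orthogonal_mx V -> orthogonal_mx (U *m V).
Proof.
move=> [UU _] [VV _]; apply: orthonormal_cols_orthogonal.
by rewrite /orthonormal_cols trmx_mul mulmxA -[_ *m U^T *m U]mulmxA UU mulmx1.
Qed.

Lemma orthogonal_mx1 n : orthogonal_mx (1%:M : 'M[R]_n).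
Proof.
by apply: orthonormal_cols_orthogonal; rewrite /orthonormal_cols trmx1 mulmx1.
Qed.

(* The reflection exchanging [u] and the first basis vector. *)
Lemma orthogonal_mx_first_col n (u : 'cV[R]_(1 + n)) : sqnorm u = 1 ->
  exists2 H : 'M[R]_(1 + n), orthogonal_mx H & H *m delta_mx 0 0 = u.
Proof.
move=> u1; set e := delta_mx 0 0 : 'cV[R]_(1 + n).
have [->|neq_ue] := eqVneq u e.
  by exists 1%:M; [exact: orthogonal_mx1 | rewrite mul1mx].
pose w := u - e; pose q := sqnorm w.
have q0 : q != 0 by rewrite sqnorm_eq0 subr_eq0.
have ww : w^T *m w = q%:M by rewrite [LHS]mx11_scalar -sqnormE.
have uu : u^T *m u = 1%:M by rewrite [LHS]mx11_scalar -sqnormE u1.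
have ee : e^T *m e = 1%:M by rewrite [LHS]mx11_scalar -sqnormE sqnorm_delta.
(* Since [|u| = |e| = 1], [q = 2 - 2 u^T e], whence [w^T e = u^T e - 1 = - q / 2]. *)
have we : w^T *m e = (- (q / 2))%:M.
  have ue : e^T *m u = u^T *m e.
    rewrite -[LHS]trmxK trmx_mul trmxK.
    by apply/matrixP => i j; rewrite mxE !ord1.
  have [t ut] : exists t, u^T *m e = t%:M.
    by exists ((u^T *m e) 0 0); rewrite [LHS]mx11_scalar.
  move: ww; rewrite /w [(u - e)^T]linearB /= mulmxBl !mulmxBr uu ee ue ut.
  rewrite -!raddfB /= => /(congr1 (fun M : 'M[R]_1 => M 0 0)).
  rewrite [LHS]mxE [RHS]mxE !mulr1n => <-.
  rewrite [(u - e)^T]linearB /= mulmxBl ee ut -raddfB /=.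
  by congr (_ %:M); field.
exists (1%:M - (2 / q) *: (w *m w^T)).
  apply: orthonormal_cols_orthogonal; rewrite /orthonormal_cols.
  rewrite [(1%:M - _)^T]linearB /= [(_ *: _)^T]linearZ /= trmx1 trmx_mul.
  rewrite trmxK mulmxBl !mulmxBr !mul1mx mulmx1.
  rewrite -scalemxAl -scalemxAr mulmxA -[w *m w^T *m w]mulmxA ww.
  rewrite mul_mx_scalar -scalemxAl !scalerA.
  have -> : 2 / q * (2 / q * q) = 2 / q + 2 / q by field.
  by rewrite scalerDl opprB addrK subrK.
rewrite mulmxBl mul1mx -scalemxAl -mulmxA we mul_mx_scalar scalerA.
have -> : 2 / q * - (q / 2) = -1 by field.
by rewrite scaleN1r opprK /w addrC subrK.
Qed.

End SquaredNorm.

(** * Existence of the singular value decomposition *)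

Section SingularValues.
Variable R : realType.

Lemma continuous_sum_fin (T : topologicalType) (I : Type) (r : seq I)
    (f : I -> T -> R) :
  (forall i, continuous (f i)) -> continuous (fun x => \sum_(i <- r) f i x).
Proof.
move=> fc x; elim: r => [|i r IH].
  by under eq_fun do rewrite big_nil; exact: cvg_cst.
by under eq_fun do rewrite big_cons; apply: cvgD => //; apply: fc.
Qed.

Lemma continuous_sqnorm_mulmx m n (M : 'M[R]_(m, n)) :
  continuous (fun x : 'rV[R]_n => sqnorm (M *m x^T)).
Proof.
apply: continuous_sum_fin => i x.
have H : continuous (fun y : 'rV[R]_n => (M *m y^T) i 0).
  under eq_fun do rewrite mxE.
  apply: continuous_sum_fin => j y; under eq_fun do rewrite mxE.
  apply: (@continuousM _ _ (fun=> M i j) (fun y : 'rV[R]_n => y 0 j));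
    [exact: cst_continuous | exact: coord_continuous].
by under eq_fun do rewrite expr2; apply: continuousM; exact: H.
Qed.

(** A closed subset of the cube [[-1, 1]^n], since each squared coordinate is at most the whole
    sum. *)
Lemma compact_sphere n : compact [set x : 'rV[R]_n | sqnorm x^T = 1].
Proof.
have cube : compact [set v : 'rV[R]_n | forall i, v ord0 i \in `[(-1), 1]].
  exact: (@rV_compact R n (fun=> `[(-1), 1]%classic)
    (fun=> @segment_compact R _ _)).
apply: subclosed_compact cube _.
- apply: (@preimage_closed _ _ (fun x : 'rV[R]_n => sqnorm x^T) [set y | y = 1]);
    last exact: closed_eq.
  move=> x _; have := @continuous_sqnorm_mulmx n n 1%:M x.
  by under eq_fun do rewrite mul1mx.
- move=> x /= x1 i; rewrite in_itv /=.
  suff : x 0 i ^+ 2 <= 1 by nra.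
  rewrite -x1 /sqnorm (bigD1 i) //= mxE lerDl.
  by apply: sumr_ge0 => j _; rewrite sqr_ge0.
Qed.

(** The extreme value theorem gives a maximizer on the unit sphere, nonempty in dimension [n.+1];
    homogeneity extends the bound to every [x]. *)
Lemma sqnorm_mulmx_max m n (M : 'M[R]_(m, n.+1)) :
  exists2 v : 'cV[R]_n.+1, sqnorm v = 1 &
    forall x, sqnorm (M *m x) <= sqnorm (M *m v) * sqnorm x.
Proof.
have [|v vS vmax] := @EVT_max_rV R n.+1 (fun x => sqnorm (M *m x^T)) _ _
  (@compact_sphere n.+1)
  (continuous_subspaceT (@continuous_sqnorm_mulmx _ _ M)).
  by exists (delta_mx 0 0); rewrite /= trmx_delta sqnorm_delta.
exists v^T; first by move: vS; rewrite inE.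
move=> x; have [->|x0] := eqVneq x 0.
  by rewrite mulmx0 !sqnorm0 mulr0.
have q0 : 0 < sqnorm x by rewrite sqnorm_gt0.
have sq : (Num.sqrt (sqnorm x))^-1 ^+ 2 = (sqnorm x)^-1.
  by rewrite exprVn sqr_sqrtr // ltW.
have := vmax ((Num.sqrt (sqnorm x))^-1 *: x)^T.
rewrite inE /= !trmxK -scalemxAr !sqnormZ sq mulVf ?gt_eqF //.
by move=> /(_ erefl); rewrite ler_pdivrMl // mulrC.
Qed.

(** An index past the end reads the default [0], which is below every entry because the entries are
    nonnegative. *)
Lemma sorted_nth_ge (s : seq R) i j : sorted >=%R s -> all (>= 0) s ->
  (i <= j)%N -> s`_j <= s`_i.
Proof.
move=> ss s0 ij; have [js|js] := ltnP j (size s).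
  by apply: (sorted_leq_nth ge_trans ge_refl) => //; rewrite inE (leq_ltn_trans ij).
rewrite (nth_default _ js); have [iS|iS] := ltnP i (size s).
  exact: (allP s0) (mem_nth _ iS).
by rewrite nth_default.
Qed.

Lemma nth_ge0 (s : seq R) i : all (>= 0) s -> 0 <= s`_i.
Proof.
move=> s0; have [iS|iS] := ltnP i (size s); last by rewrite nth_default.
exact: (allP s0) (mem_nth _ iS).
Qed.

Lemma rect_diag_mxT m n (s : seq R) : (rect_diag_mx m n s)^T = rect_diag_mx n m s.
Proof.
by apply/matrixP => i j; rewrite !mxE eq_sym; case: eqP => // ->.
Qed.

Lemma rect_diag_mx_gram m n (s : seq R) : (size s <= m)%N ->
  (rect_diag_mx m n s)^T *m rect_diag_mx m n s = diag_mx (\row_i s`_i ^+ 2).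
Proof.
move=> sm; apply/matrixP => i j; rewrite !mxE.
have [im|im] := ltnP i m.
  rewrite (bigD1 (Ordinal im)) //= !mxE eqxx big1 ?addr0; last first.
    move=> k ki; rewrite !mxE; case: eqP => [kE|]; last by rewrite mul0r.
    by case/eqP: ki; apply: val_inj.
  have -> : (i == j :> nat) = (i == j) by [].
  by case: eqP => _; rewrite ?mulr0 // mulr1n expr2.
(* For [i >= m] column [i] vanishes, and the entry of [s] at [i] is the default [0]. *)
rewrite nth_default ?(leq_trans sm) // expr0n /= mul0rn big1 // => k _.
rewrite !mxE; case: eqP => [kE|]; last by rewrite mul0r.
by move: im; rewrite -kE leqNgt ltn_ord.
Qed.

Lemma sqnorm_rect_diag_mx m n (s : seq R) (y : 'cV[R]_n) : (size s <= m)%N ->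
  sqnorm (rect_diag_mx m n s *m y) = \sum_(i < n) s`_i ^+ 2 * y i 0 ^+ 2.
Proof.
move=> sm; rewrite sqnorm_mulmx rect_diag_mx_gram // mul_mx_diag mxE.
by apply: eq_bigr => i _; rewrite !mxE expr2; ring.
Qed.

Lemma rect_diag_mx_block k d a (s : seq R) :
  rect_diag_mx (1 + k) (1 + d) (a :: s) = block_mx a%:M 0 0 (rect_diag_mx k d s).
Proof.
apply/matrixP => i j; rewrite !mxE.
case: (split_ordP i) => i' ->; rewrite mxE; case: (split_ordP j) => j' -> /=;
  rewrite !mxE ?ord1 //=.
Qed.

(** [U] is an isometry, so only the coordinates of [x] along the right singular vectors count; terms
    with [i >= minn m n] vanish through the default [0]. *)
Lemma sqnorm_svd m n (M : 'M[R]_(m, n)) s (U : 'M[R]_m) (V : 'M[R]_n) x :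
    size s = minn m n -> orthogonal_mx U -> M = U *m rect_diag_mx m n s *m V^T ->
  sqnorm (M *m x) = \sum_(i < n) s`_i ^+ 2 * (V^T *m x) i 0 ^+ 2.
Proof.
move=> ss [UU _] ->; rewrite -!mulmxA sqnorm_isometry //.
by rewrite sqnorm_rect_diag_mx // ss geq_minl.
Qed.

Lemma orthogonal_mx_block n (U : 'M[R]_n) : orthogonal_mx U ->
  orthogonal_mx (block_mx 1%:M 0 0 U : 'M[R]_(1 + n)).
Proof.
move=> [UU _]; apply: orthonormal_cols_orthogonal; rewrite /orthonormal_cols.
rewrite tr_block_mx mulmx_block !trmx0 !mul0mx !mulmx0 trmx1 mul1mx UU.
by rewrite !addr0 !add0r [RHS]scalar_mx_block.
Qed.

(** Take for [x] the first right singular vector. The list [s] is arbitrary because the bound serves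
    inside the existence proof, before uniqueness is known. *)
Lemma singular_values_first_le m n (M : 'M[R]_(m, n)) (a : R) s :
    is_singular_values M s -> 0 <= a ->
    (forall x, sqnorm (M *m x) <= a ^+ 2 * sqnorm x) ->
  s`_0 <= a.
Proof.
case=> ss _ s0 [U [V [oU [VV _] ME]]] a0 Ma.
have [sz|sz] := posnP (size s); first by rewrite nth_default ?sz.
have n0 : (0 < n)%N by move: sz; rewrite ss leq_min => /andP[].
have := Ma (V *m delta_mx (Ordinal n0) 0).
rewrite (sqnorm_svd _ ss oU ME) mulmxA VV mul1mx sqnorm_isometry //.
rewrite sqnorm_delta mulr1 (bigD1 (Ordinal n0)) //= mxE !eqxx expr1n mulr1.
rewrite big1 ?addr0; last first.
  by move=> i /negbTE i0; rewrite mxE i0 expr0n mulr0.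
by rewrite ler_pXn2r // nnegrE ?nth_ge0.
Qed.

Lemma exists_singular_values m n (M : 'M[R]_(m, n)) :
  exists s, is_singular_values M s.
Proof.
have zero k d : exists s, is_singular_values (0 : 'M[R]_(k, d)) s.
  exists (nseq (minn k d) 0); split; first by rewrite size_nseq.
  - by apply/(sortedP 0) => i _; rewrite !nth_nseq !if_same /=; apply: lexx.
  - by rewrite all_nseq /= lexx orbT.
  exists 1%:M, 1%:M; split; [exact: orthogonal_mx1|exact: orthogonal_mx1|].
  rewrite mul1mx trmx1 mulmx1; apply/matrixP => i j.
  by rewrite !mxE nth_nseq !if_same.
elim: m n M => [|m IH] [|n] M; try by rewrite ?(flatmx0 M) ?(thinmx0 M).
have [v v1 vmax] := sqnorm_mulmx_max M.
have [Mv0|Mv0] := eqVneq (sqnorm (M *m v)) 0.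
  suff -> : M = 0 by exact: zero.
  apply/matrixP => i j; have := vmax (delta_mx j 0).
  rewrite Mv0 mul0r => Mj; have : sqnorm (M *m delta_mx j 0) == 0.
    by rewrite eq_le Mj sqnorm_ge0.
  by rewrite sqnorm_eq0 -colE => /eqP/colP/(_ i); rewrite !mxE.
pose a := Num.sqrt (sqnorm (M *m v)).
have a2 : a ^+ 2 = sqnorm (M *m v) by rewrite sqr_sqrtr ?sqnorm_ge0.
have a0 : 0 < a by rewrite sqrtr_gt0 lt0r Mv0 sqnorm_ge0.
have u1 : sqnorm (a^-1 *: (M *m v)) = 1.
  by rewrite sqnormZ -a2 -exprMn mulVf ?gt_eqF // expr1n.
have [K oK Ku] := orthogonal_mx_first_col u1.
have [H oH Hv] := orthogonal_mx_first_col v1.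
(* In the new bases the matrix keeps the bound [a], and its first column becomes [a] times the first
   basis vector. *)
pose M' := K^T *m M *m H : 'M[R]_(1 + m, 1 + n).
have M'E : K *m M' *m H^T = M.
  by case: oK oH => [_ KK] [_ HH]; rewrite !mulmxA KK mul1mx -mulmxA HH mulmx1.
have M'le x : sqnorm (M' *m x) <= a ^+ 2 * sqnorm x.
  rewrite -!mulmxA (le_trans (sqnorm_trmx_le _ oK.1)) // a2.
  by rewrite (le_trans (vmax _)) // (sqnorm_isometry x oH.1).
have M'0 : M' *m (delta_mx 0 0 : 'cV_(1 + n)) = a *: delta_mx 0 0.
  rewrite /M' -!mulmxA Hv -[M *m v]scale1r -(divff (negbT (gt_eqF a0))).
  by rewrite -scalerA -Ku -scalemxAr mulmxA oK.1 mul1mx.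
clearbody M'.
have ulM : ulsubmx M' = a%:M.
  apply/matrixP => i j; rewrite !ord1 !mxE.
  have /colP/(_ 0) := M'0; rewrite -colE !mxE !lshift0 => ->.
  by rewrite !eqxx mulr1.
have dlM : dlsubmx M' = 0.
  apply/matrixP => i j; rewrite !ord1 !mxE.
  have /colP/(_ (rshift 1 i)) := M'0; rewrite -colE !mxE !lshift0 => ->.
  by rewrite /= mulr0.
have urM : ursubmx M' = 0.
  pose w := (ursubmx M')^T; pose b := sqnorm w.
  (* Testing on the first row [(a, w^T)] gives [(a^2 + b)^2 + c <= a^2 (a^2 + b)] with [c >= 0],
     which forces [b = 0]. *)
  have := M'le (col_mx a%:M w).
  rewrite -{1}[M']submxK mul_block_col ulM dlM !sqnorm_col_mx sqnorm_scalar.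
  rewrite -scalar_mxM.
  have -> : ursubmx M' *m w = b%:M.
    by rewrite [LHS]mx11_scalar /b sqnormE trmxK.
  rewrite -raddfD sqnorm_scalar -/b => Hle.
  suff /eqP : b = 0.
    by rewrite sqnorm_eq0 => /eqP w0; apply: trmx_inj; rewrite trmx0; exact: w0.
  have b0 : 0 <= b := sqnorm_ge0 _.
  have c0 := sqnorm_ge0 (0 *m a%:M + drsubmx M' *m w).
  have aa : 0 < a ^+ 2 by rewrite exprn_gt0.
  by nra.
have [s' [ss' so' s0' [U [V [oU oV NE]]]]] := IH n (drsubmx M').
(* The lower block inherits the bound [a] from vectors with first coordinate zero, so prepending [a]
   keeps the list sorted. *)
have s'a : s'`_0 <= a.
  apply: (@singular_values_first_le _ _ (drsubmx M')) (ltW a0) _.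
    by split=> //; exists U, V.
  move=> x; have := M'le (col_mx 0 x).
  rewrite -{1}[M']submxK mul_block_col urM mul0mx mulmx0 addr0 !sqnorm_col_mx.
  by rewrite !sqnorm0 !add0r dlM mul0mx add0r.
exists (a :: s'); split.
- by rewrite /= ss' minnSS.
- by case: (s') s'a so' => //= h t ->.
- by rewrite /= ltW.
exists (K *m block_mx 1%:M 0 0 U), (H *m block_mx 1%:M 0 0 V); split.
- exact/orthogonal_mxM/orthogonal_mx_block.
- exact/orthogonal_mxM/orthogonal_mx_block.
rewrite -M'E.
have <- : (block_mx 1%:M 0 0 U : 'M[R]_(1 + m)) *m 
    rect_diag_mx (1 + m) (1 + n) (a :: s')
    *m (block_mx 1%:M 0 0 V : 'M[R]_(1 + n))^T = M'.
  rewrite rect_diag_mx_block tr_block_mx !mulmx_block !trmx0 trmx1.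
  rewrite !(mul0mx, mulmx0, addr0, add0r) mul1mx mulmx1 -NE.
  by rewrite -[RHS]submxK ulM urM dlM.
by rewrite trmx_mul !mulmxA.
Qed.

End SingularValues.

(** * Comparison and uniqueness of singular values; spectral and Schatten norms *)

Section Comparison.
Variable R : realType.

(* Courant-Fischer argument: some nonzero [x] is orthogonal to the right singular
   vectors of [M] of index [> i] and to those of [N] of index [< i], as these are
   only [d - 1] linear conditions. *)
Lemma singular_values_le k l d (M : 'M[R]_(k, d)) (N : 'M[R]_(l, d)) s t (a : R) i :
    is_singular_values M s -> is_singular_values N t -> 0 <= a ->
    (forall x, sqnorm (M *m x) <= a ^+ 2 * sqnorm (N *m x)) ->
  s`_i <= a * t`_i.
Proof.
case=> ss so s0 [U [V [oU oV ME]]] [st to t0 [W [Z [oW oZ NE]]]] a0 MN.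
have [iS|iS] := leqP (size s) i.
  by rewrite nth_default // mulr_ge0 // nth_ge0.
have id : (i < d)%N by move: iS; rewrite ss leq_min => /andP[].
(* Column [i] of [C] is zero, so [C] is singular, and a vector [v] of its left kernel meets all the
   orthogonality conditions at once. *)
pose C : 'M[R]_d := \matrix_(j, e)
  if (e < i)%N then Z j e else if (i < e)%N then V j e else 0.
have /det0P[v v0 vC] : \det C == 0.
  rewrite -det_tr (expand_det_row _ (Ordinal id)) big1 // => j _.
  by rewrite !mxE ltnn mul0r.
pose x := v^T.
have x0 : 0 < sqnorm x by rewrite sqnorm_gt0 -trmx0 (inj_eq trmx_inj).
have coord (Y : 'M[R]_d) e : (forall j, C j e = Y j e) -> (Y^T *m x) e 0 = 0.
  move=> CY; have /matrixP/(_ 0 e) := vC; rewrite [LHS]mxE [RHS]mxE => vCe.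
  rewrite -[RHS]vCe [LHS]mxE; apply: eq_bigr => j _.
  by rewrite CY [_^T e j]mxE [x j 0]mxE mulrC.
have Vx (e : 'I_d) : (i < e)%N -> (V^T *m x) e 0 = 0.
  by move=> ie; apply: coord => j; rewrite mxE ie ltnNge ltnW.
have Zx (e : 'I_d) : (e < i)%N -> (Z^T *m x) e 0 = 0.
  by move=> ei; apply: coord => j; rewrite mxE ei.
(* [x] is a combination of right singular vectors of [M] of index at most [i], whose singular values
   are at least the [i]-th; dually for [N] below. *)
have Mx : s`_i ^+ 2 * sqnorm x <= sqnorm (M *m x).
  rewrite (sqnorm_svd _ ss oU ME) -(sqnorm_isometry x (orthogonal_mxT oV).1).
  rewrite mulr_sumr; apply: ler_sum => e _.
  have [ei|ie] := leqP e i; last by rewrite Vx // expr0n !mulr0.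
  rewrite ler_wpM2r ?sqr_ge0 // ler_pXn2r ?nnegrE ?nth_ge0 //.
  exact: sorted_nth_ge.
have Nx : sqnorm (N *m x) <= t`_i ^+ 2 * sqnorm x.
  rewrite (sqnorm_svd _ st oW NE) -(sqnorm_isometry x (orthogonal_mxT oZ).1).
  rewrite mulr_sumr; apply: ler_sum => e _.
  have [ie|ei] := leqP i e; last by rewrite Zx // expr0n !mulr0.
  rewrite ler_wpM2r ?sqr_ge0 // ler_pXn2r ?nnegrE ?nth_ge0 //.
  exact: sorted_nth_ge.
have : s`_i ^+ 2 <= (a * t`_i) ^+ 2.
  rewrite -(ler_pM2r x0) (le_trans Mx) // (le_trans (MN x)) // exprMn -[leRHS]mulrA.
  by rewrite ler_wpM2l // sqr_ge0.
by rewrite ler_pXn2r // nnegrE ?mulr_ge0 ?nth_ge0.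
Qed.

(** Comparing [M] with itself, with [a = 1], bounds each list by the other. *)
Lemma singular_values_uniq m n (M : 'M[R]_(m, n)) s t :
  is_singular_values M s -> is_singular_values M t -> s = t.
Proof.
move=> sM tM; have [ss _ _ _] := sM; have [st _ _ _] := tM.
apply: (@eq_from_nth _ 0) => [|i _]; first by rewrite ss st.
have le s' t' : is_singular_values M s' -> is_singular_values M t' -> s'`_i <= t'`_i.
  move=> sM' tM'; rewrite -[leRHS]mul1r; apply: singular_values_le sM' tM' _ _ => //.
  by move=> x; rewrite expr1n mul1r.
by apply/eqP; rewrite eq_le !le.
Qed.

Lemma singular_valuesP m n (M : 'M[R]_(m, n)) :
  is_singular_values M (singular_values M).
Proof. exact: xgetPex (exists_singular_values M). Qed.

Lemma singular_values_eq m n (M : 'M[R]_(m, n)) s :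
  is_singular_values M s -> singular_values M = s.
Proof. exact/singular_values_uniq/singular_valuesP. Qed.

Lemma singular_values_ge0 m n (M : 'M[R]_(m, n)) i : 0 <= (singular_values M)`_i.
Proof. by have [_ _ s0 _] := singular_valuesP M; exact: nth_ge0. Qed.

Lemma singular_values_tr m n (M : 'M[R]_(m, n)) :
  singular_values M^T = singular_values M.
Proof.
apply: singular_values_eq; have [ss so s0 [U [V [oU oV ME]]]] := singular_valuesP M.
split; rewrite // 1?minnC //; exists V, U; split=> //.
by rewrite {1}ME !trmx_mul trmxK rect_diag_mxT mulmxA.
Qed.

Lemma singular_values_orthogonal_mul m n (P : 'M[R]_m) (M : 'M[R]_(m, n)) (O : 'M[R]_n) :
    orthogonal_mx P -> orthogonal_mx O ->
  singular_values (P *m M *m O) = singular_values M.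
Proof.
move=> oP oO; apply: singular_values_eq.
have [ss so s0 [U [V [oU oV ME]]]] := singular_valuesP M.
split=> //; exists (P *m U), (O^T *m V); split.
- exact: orthogonal_mxM.
- exact: orthogonal_mxM (orthogonal_mxT oO) oV.
by rewrite {1}ME trmx_mul trmxK !mulmxA.
Qed.

Lemma spectral_norm_ge0 m n (M : 'M[R]_(m, n)) : 0 <= spectral_norm M.
Proof. exact: singular_values_ge0. Qed.

Lemma spectral_norm_tr m n (M : 'M[R]_(m, n)) : spectral_norm M^T = spectral_norm M.
Proof. by rewrite /spectral_norm singular_values_tr. Qed.

Lemma sqnorm_mulmx_le m n (M : 'M[R]_(m, n)) x :
  sqnorm (M *m x) <= spectral_norm M ^+ 2 * sqnorm x.
Proof.
have [ss so s0 [U [V [oU oV ME]]]] := singular_valuesP M.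
rewrite (sqnorm_svd _ ss oU ME) -(sqnorm_isometry x (orthogonal_mxT oV).1).
rewrite mulr_sumr; apply: ler_sum => i _.
rewrite ler_wpM2r ?sqr_ge0 // ler_pXn2r ?nnegrE ?nth_ge0 //.
exact: sorted_nth_ge.
Qed.

Lemma spectral_norm_le m n (M : 'M[R]_(m, n)) a : 0 <= a ->
  (forall x, sqnorm (M *m x) <= a ^+ 2 * sqnorm x) -> spectral_norm M <= a.
Proof. exact/singular_values_first_le/singular_valuesP. Qed.

Lemma schatten_norm_ge0 p m n (M : 'M[R]_(m, n)) : 0 <= schatten_norm p M.
Proof. by case: p => [r||] //=; rewrite ?powR_ge0 ?spectral_norm_ge0. Qed.

(** The singular values compare index by index. With [k <= l] the list of [M] is no longer than that
    of [N], so its sum of powers can be padded with zero terms. *)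
Lemma schatten_norm_le (p : \bar R) k l d (M : 'M[R]_(k, d)) (N : 'M[R]_(l, d)) (a : R) :
    (1 <= p)%E -> (k <= l)%N -> 0 <= a ->
    (forall x, sqnorm (M *m x) <= a ^+ 2 * sqnorm (N *m x)) ->
  schatten_norm p M <= a * schatten_norm p N.
Proof.
move=> p1 kl a0 MN.
have le i := singular_values_le i (singular_valuesP M) (singular_valuesP N) a0 MN.
case: p p1 => [p||] //= p1; last exact: le.
rewrite lee_fin in p1; have p0 : 0 < p := lt_le_trans ltr01 p1.
set s := singular_values M; set t := singular_values N.
have st : (size s <= size t)%N.
  have [-> _ _ _] := singular_valuesP M; have [-> _ _ _] := singular_valuesP N.
  by rewrite leq_min geq_minr (leq_trans (geq_minl _ _)).
have sum_ge0 (r : seq R) : 0 <= \sum_(x <- r) x `^ p.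
  by apply: sumr_ge0 => x _; exact: powR_ge0.
have t0 i : 0 <= t`_i by exact: singular_values_ge0.
(* This moves [a] under the outer root, leaving a comparison of sums of [p]-th powers. *)
have -> : a = (a `^ p) `^ p^-1 by rewrite -powRrM divff ?gt_eqF // powRr1.
rewrite -powRM ?powR_ge0 //.
apply: ge0_ler_powR; rewrite ?nnegrE ?invr_ge0 ?(ltW p0) ?mulr_ge0 ?powR_ge0 //.
rewrite mulr_sumr [leLHS](big_nth 0) [leRHS](big_nth 0) -/s -/t !big_mkord.
rewrite (big_ord_widen _ (fun i => s`_i `^ p) st) big_mkcond /=.
apply: ler_sum => i _; rewrite -powRM //.
case: ifP => _; last exact: powR_ge0.
apply: ge0_ler_powR; rewrite ?nnegrE ?(ltW p0) ?mulr_ge0 //.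
exact: singular_values_ge0.
Qed.

End Comparison.

(** * Moore-Penrose inverses of matrices of full column rank *)

Section MoorePenrose.
Variable R : realType.

(** Any other solution [Y] of the Penrose equations has [Y M = 1], and
    [M Y = (M X M Y)^T = M Y M X = M X]; multiplying by [X] on the left gives [Y = X]. *)
Lemma mpinv_left_inverse m n (M : 'M[R]_(m, n)) (X : 'M[R]_(n, m)) :
  X *m M = 1%:M -> (M *m X)^T = M *m X -> mpinv M = X.
Proof.
move=> XM MXT; apply: xget_unique => [|Y [MYM YMY MYT _]].
  by split; rewrite -?mulmxA ?XM ?mulmx1 // ?mulmxA ?XM ?mul1mx // trmx1.
have YM : Y *m M = 1%:M by rewrite -XM -[in RHS]MYM !mulmxA XM mul1mx.
have MYX : M *m Y = M *m X.
  by rewrite -MYT -[Y]mul1mx -XM -mulmxA mulmxA trmx_mul MYT MXT -mulmxA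
    [Y *m (M *m X)]mulmxA YM mul1mx.
by rewrite -[Y]mul1mx -XM -mulmxA MYX mulmxA XM mul1mx.
Qed.

(** The factor [T] cancels in [M T T^-1 X = M X], which stays symmetric. This serves both [A = Q T]
    and [S A = (S Q) T]. *)
Lemma mpinv_mulmx_unit m n (M : 'M[R]_(m, n)) (X : 'M[R]_(n, m)) (T : 'M[R]_n) :
    X *m M = 1%:M -> (M *m X)^T = M *m X -> T \in unitmx ->
  mpinv (M *m T) = invmx T *m X.
Proof.
move=> XM MXT uT; apply: mpinv_left_inverse.
  by rewrite mulmxA -[_ *m X *m M]mulmxA XM mulmx1 mulVmx.
by rewrite mulmxA mulmxK.
Qed.

End MoorePenrose.

(** * Principal angles computed from orthonormal bases *)

Section PrincipalAngles.
Variable R : realType.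

Lemma col_range_mulmx m k (U : 'M[R]_(m, k)) (x : 'cV_k) : U *m x \in col_range U.
Proof. by apply/memv_imgP; exists x; rewrite ?memvf // lfunE. Qed.

Lemma dim_col_range m k (U : 'M[R]_(m, k)) :
  orthonormal_cols U -> \dim (col_range U) = k.
Proof.
move=> UU; rewrite limg_dim_eq; first by rewrite dimvf /dim /= muln1.
apply/eqP; rewrite -subv0; apply/subvP => x; rewrite memv_cap => /andP[_].
by rewrite memv_ker lfunE /= memv0 -!sqnorm_eq0 sqnorm_isometry.
Qed.

(** [U U^T] fixes every vector of the range of [U], in particular the columns of [U']. *)
Lemma col_range_orthonormal_proj m k l (U : 'M[R]_(m, k)) (U' : 'M[R]_(m, l)) :
  orthonormal_cols U -> col_range U' = col_range U -> U' = U *m (U^T *m U').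
Proof.
move=> UU UU'; apply/matrixP => i j.
have : U' *m delta_mx j 0 \in col_range U by rewrite -UU' col_range_mulmx.
move=> /memv_imgP[x _]; rewrite lfunE /= => E.
have : U' *m (delta_mx j 0 : 'cV[R]_l) = U *m (U^T *m U') *m delta_mx j 0.
  by rewrite -!mulmxA E [U^T *m _]mulmxA UU mul1mx.
by rewrite -!colE => /colP/(_ i); rewrite !mxE.
Qed.

Lemma orthonormal_bases_change m k (U U' : 'M[R]_(m, k)) :
    orthonormal_cols U -> orthonormal_cols U' -> col_range U' = col_range U ->
  orthogonal_mx (U^T *m U').
Proof.
move=> UU UU' E; apply: orthonormal_cols_orthogonal.
have := UU'; rewrite /orthonormal_cols trmx_mul trmxK -mulmxA.
by rewrite -(col_range_orthonormal_proj UU E).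
Qed.

(** Changing the two bases multiplies [U^T V] on both sides by orthogonal matrices, which leaves its
    singular values unchanged. *)
Lemma principal_angles_orthonormal m k l (U : 'M[R]_(m, k)) (V : 'M[R]_(m, l)) :
    orthonormal_cols U -> orthonormal_cols V ->
  principal_angles (col_range U) (col_range V) =
  map acos (singular_values (U^T *m V)).
Proof.
move=> UU VV; rewrite /principal_angles !dim_col_range //.
apply: xget_unique; first by exists U, V.
move=> _ [U' [V' [[UU' EU] [VV' EV] ->]]]; congr (map _ _).
have UE := col_range_orthonormal_proj UU EU.
have VE := col_range_orthonormal_proj VV EV.
have oP := orthogonal_mxT (orthonormal_bases_change UU UU' EU).
have oO := orthonormal_bases_change VV VV' EV.
by rewrite UE VE trmx_mul -(singular_values_orthogonal_mul (U^T *m V) oP oO) !mulmxA.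
Qed.

Lemma acos_le (x y : R) : 0 <= x -> x <= y -> y <= 1 -> acos y <= acos x.
Proof.
move=> x0 xy y1; have xB : -1 <= x <= 1 by apply/andP; split; lra.
have yB : -1 <= y <= 1 by apply/andP; split; lra.
rewrite leNgt -ltr_cos ?in_itv /= ?acos_ge0 ?acos_lepi //.
by rewrite !acosK ?in_itv //= -leNgt.
Qed.

Lemma etan_acos (x : R) : 0 <= x <= 1 ->
  etan (acos x) = if x == 0 then +oo%E else (Num.sqrt (1 - x ^+ 2) / x)%:E.
Proof.
move=> /andP[x0 x1]; have xB : -1 <= x <= 1 by apply/andP; split; lra.
have cx : cos (acos x) = x by rewrite acosK // in_itv.
rewrite /etan; case: (eqVneq x 0) => [->|xn0]; first by rewrite acos0 eqxx.
case: eqVneq => [E|_]; last by rewrite /tan cx sin_acos.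
by move: xn0; rewrite -cx E cos_pihalf eqxx.
Qed.

(** As [acos] is decreasing, the largest angle comes from the last and smallest cosine; angles are
    nonnegative, so the initial value [0] of the maximum is harmless. *)
Lemma bigmax_map_acos n (s : seq R) : size s = n.+1 -> sorted >=%R s ->
  all (>= 0) s -> s`_0 <= 1 ->
  \big[Num.max/0]_(t <- map acos s) t = acos s`_n.
Proof.
move=> ss so s0 s1; have sn1 i : s`_i <= 1 := le_trans (sorted_nth_ge so s0 (leq0n i)) s1.
rewrite big_map (big_nth 0) big_mkord ss; apply/le_anti/andP; split.
  apply/bigmax_leP; split=> [|i _].
    by rewrite acos_ge0 // sn1 andbT; have := nth_ge0 n s0; lra.
  by apply: acos_le; rewrite ?nth_ge0 ?sn1 // sorted_nth_ge // -ltnS.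
exact: (le_bigmax _ (fun i : 'I_n.+1 => acos s`_i) ord_max).
Qed.

End PrincipalAngles.

(** * Gram matrices and the spectral norm of [(S Q)^+ S Qp] *)

Section SketchedSubspace.
Variable R : realType.

Lemma is_singular_values_gram m n (M : 'M[R]_(m, n)) s : is_singular_values M s ->
  exists2 V : 'M[R]_n, orthogonal_mx V &
    M^T *m M = V *m diag_mx (\row_i s`_i ^+ 2) *m V^T.
Proof.
case=> ss _ _ [U [V [[UU _] oV ->]]]; exists V => //.
rewrite -(@rect_diag_mx_gram _ m) ?ss ?geq_minl // !trmx_mul trmxK !mulmxA.
by rewrite -[_ *m U^T *m U]mulmxA UU mulmx1.
Qed.

(** With all singular values positive, [W] is [(M^T M)^-1] and [M^+ = W M^T]. The diagonal form of
    [W] is kept for the norm computation. *)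
Lemma gram_inverse m n (M : 'M[R]_(m, n.+1)) :
    0 < (singular_values M)`_n ->
  exists V W : 'M[R]_n.+1,
    [/\ orthogonal_mx V, W = V *m diag_mx (\row_i (singular_values M)`_i ^- 2) *m V^T,
        W *m (M^T *m M) = 1%:M & mpinv M = W *m M^T].
Proof.
set s := singular_values M => sn0; have sM : is_singular_values M s := singular_valuesP M.
have [_ so s0 _] := sM.
have [V oV G] := is_singular_values_gram sM; exists V.
set D := \row_i _; set W := V *m diag_mx D *m V^T; exists W.
have [VV VV'] := oV.
have WG : W *m (M^T *m M) = 1%:M.
  rewrite G !mulmxA -[_ *m V^T *m V]mulmxA VV mulmx1 -[V *m _ *m _]mulmxA.
  suff -> : diag_mx D *m diag_mx (\row_i s`_i ^+ 2) = 1%:M by rewrite mulmx1.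
  rewrite mulmx_diag; apply/matrixP => i j; rewrite !mxE mulVf //.
  by rewrite gt_eqF // exprn_gt0 // (lt_le_trans sn0) // sorted_nth_ge // -ltnS.
have WT : W^T = W by rewrite /W !trmx_mul trmxK tr_diag_mx mulmxA.
clearbody W; split=> //; apply: mpinv_left_inverse; first by rewrite -mulmxA.
by rewrite !trmx_mul trmxK WT mulmxA.
Qed.

(** The norm is computed on the transpose, whose squared norm is a diagonal form in the right
    singular vectors of [S Q]; the largest coefficient, [1 / s^2 - 1], is attained at the last of
    them. *)
Lemma spectral_norm_sketch c m k n (S : 'M[R]_(c, m)) (Q : 'M[R]_(m, n.+1))
    (Qp : 'M[R]_(m, k)) (s := (singular_values (S *m Q))`_n) :
    orthonormal_rows S -> Q *m Q^T + Qp *m Qp^T = 1%:M -> 0 < s ->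
  spectral_norm (mpinv (S *m Q) *m (S *m Qp)) = Num.sqrt (1 - s ^+ 2) / s.
Proof.
move=> SS QQ s0; set N := S *m Q.
have [V [W [oV]]] := gram_inverse s0; set D := \row_i _ => WE WG MP.
have [VV VV'] := oV.
have [_ so sv0 _] := singular_valuesP N.
have WT : W^T = W by rewrite WE !trmx_mul trmxK tr_diag_mx mulmxA.
have KK : (S *m Qp) *m (S *m Qp)^T = 1%:M - N *m N^T.
  have QpE : Qp *m Qp^T = 1%:M - Q *m Q^T by rewrite -QQ addrC addrA addNr add0r.
  rewrite !trmx_mul -mulmxA [Qp *m _]mulmxA QpE mulmxBl mul1mx mulmxBr SS.
  by rewrite !mulmxA.
have XN : mpinv N *m N = 1%:M by rewrite MP -mulmxA.
have XX : mpinv N *m (mpinv N)^T = W.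
  by rewrite [X in _ *m X^T]MP trmx_mul trmxK WT mulmxA XN mul1mx.
have : mpinv N *m (S *m Qp) *m (mpinv N *m (S *m Qp))^T = W - 1%:M.
  move: (S *m Qp) (mpinv N) XN XX KK => K X XN XX KK.
  rewrite trmx_mul mulmxA -[X *m K *m _]mulmxA KK mulmxBr mulmx1 mulmxA XN mul1mx.
  by rewrite mulmxBl XX -trmx_mul XN trmx1.
set M := mpinv N *m _ => MM.
have MTE x : sqnorm (M^T *m x) =
    \sum_(i < n.+1) ((singular_values N)`_i ^- 2 - 1) * (V^T *m x) i 0 ^+ 2.
  rewrite sqnorm_mulmx trmxK MM mulmxBr mulmx1 mulmxBl [LHS]mxE [X in _ + X]mxE.
  rewrite -sqnormE -(sqnorm_isometry x (orthogonal_mxT oV).1) WE.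
  have -> : x^T *m (V *m diag_mx D *m V^T) *m x =
      (V^T *m x)^T *m diag_mx D *m (V^T *m x) by rewrite trmx_mul trmxK !mulmxA.
  rewrite mul_mx_diag mxE -sumrB; apply: eq_bigr => i _.
  by rewrite !mxE expr2; ring.
pose x : 'cV[R]_n.+1 := V *m delta_mx ord_max 0.
have x1 : sqnorm x = 1 by rewrite sqnorm_isometry // sqnorm_delta.
have Mx : sqnorm (M^T *m x) = s ^- 2 - 1.
  rewrite MTE /x mulmxA VV mul1mx (bigD1 ord_max) //= big1 => [|i /negbTE i0].
    by rewrite mxE !eqxx expr1n mulr1 addr0.
  by rewrite mxE i0 expr0n mulr0.
(* [s <= 1] follows from [1 / s^2 - 1] being a squared norm, so the square root below is a genuine
   one. *)
have s2 : 0 <= 1 - s ^+ 2.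
  have := sqnorm_ge0 (M^T *m x); rewrite Mx !subr_ge0.
  by rewrite -[X in _ -> X <= 1](invrK (s ^+ 2)) invf_le1 // invr_gt0 exprn_gt0.
have a2 : (Num.sqrt (1 - s ^+ 2) / s) ^+ 2 = s ^- 2 - 1.
  by rewrite exprMn sqr_sqrtr // exprVn mulrBl mul1r divff // expf_neq0 // gt_eqF.
have a0 : 0 <= Num.sqrt (1 - s ^+ 2) / s by rewrite divr_ge0 ?sqrtr_ge0 // ltW.
rewrite -spectral_norm_tr; apply/le_anti/andP; split.
  apply: spectral_norm_le => // y; rewrite a2 MTE.
  rewrite -(sqnorm_isometry y (orthogonal_mxT oV).1) mulr_sumr.
  apply: ler_sum => i _; rewrite ler_wpM2r ?sqr_ge0 // lerB //.
  have si : s <= (singular_values N)`_i by apply: sorted_nth_ge; rewrite // -ltnS.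
  have si0 := lt_le_trans s0 si.
  by rewrite lef_pV2 ?posrE ?exprn_gt0 // ler_pXn2r // nnegrE ltW.
have := sqnorm_mulmx_le M^T x; rewrite x1 mulr1 Mx -a2.
by rewrite ler_pXn2r ?nnegrE ?spectral_norm_ge0.
Qed.

Lemma spectral_norm_orthonormal_le1 m k l (U : 'M[R]_(m, k)) (V : 'M[R]_(m, l)) :
  orthonormal_cols U -> orthonormal_cols V -> spectral_norm (U^T *m V) <= 1.
Proof.
move=> UU VV; apply: spectral_norm_le => // x.
by rewrite expr1n mul1r -mulmxA (le_trans (sqnorm_trmx_le _ UU)) // sqnorm_isometry.
Qed.

End SketchedSubspace.

(** * The tangent identity and the perturbation bound *)

(** The norm is a real number, so its equality with the tangent is asserted when the tangent is
    finite. The condition [mule_def] rules out an indeterminate product of [+oo] and [0] on the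
    right of the bound. *)
Theorem proposition5 (R : realType) (m n c d : nat)
  (m_gt0 : (0 < m)%N) (n_gt0 : (0 < n)%N) (c_gt0 : (0 < c)%N) (d_gt0 : (0 < d)%N)
  (le_nc : (n <= c)%N) (le_cm : (c <= m)%N)
  (A : 'M[R]_(m, n)) (rankA : \rank A = n)
  (B : 'M[R]_(m, d)) (S : 'M[R]_(c, m))
  (Q : 'M[R]_(m, n)) (T : 'M[R]_n) (qrA : thin_qr A Q T)
  (Qp : 'M[R]_(m, m - n)) (QQp : orthogonal_mx (row_mx Q Qp))
  (rowsS : orthonormal_rows S) :
  let Xhat := mpinv A *m B in
  let Rhat := B - A *m Xhat in
  let Xtilde := mpinv (S *m A) *m (S *m B) in
  let tan1 := etan (largest_principal_angle (col_range S^T) (col_range Q)) in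
  ((tan1 < +oo)%E ->
     (spectral_norm (mpinv (S *m Q) *m (S *m Qp)))%:E = tan1) /\
  (forall p : \bar R, (1 <= p)%E ->
     mule_def (tan1 * (spectral_norm (mpinv A))%:E)%E (schatten_norm p Rhat)%:E ->
     ((schatten_norm p (Xtilde - Xhat))%:E
        <= tan1 * (spectral_norm (mpinv A))%:E * (schatten_norm p Rhat)%:E)%E).
Proof.
case: n n_gt0 le_nc A rankA Q T qrA Qp QQp => // n _ le_nc A _ Q T [-> QQ _ uT] Qp QQp.
move=> Xhat Rhat Xtilde tan1.
have QQp1 : Q *m Q^T + Qp *m Qp^T = 1%:M.
  by case: QQp => _; rewrite /orthonormal_rows tr_row_mx mul_row_col.
have SS : orthonormal_cols S^T by rewrite /orthonormal_cols trmxK.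
(* There are now [n.+1] columns, so index [n] is the last one and [s] is the cosine of the largest
   angle. *)
set s := (singular_values (S *m Q))`_n.
have [ss so s0 _] := singular_valuesP (S *m Q).
have s01 : 0 <= s <= 1.
  rewrite nth_ge0 //= (le_trans (sorted_nth_ge so s0 (leq0n n))) //.
  by have := spectral_norm_orthonormal_le1 SS QQ; rewrite trmxK.
have tanE : tan1 = if s == 0 then +oo%E else (Num.sqrt (1 - s ^+ 2) / s)%:E.
  rewrite -etan_acos // /tan1 /largest_principal_angle.
  rewrite principal_angles_orthonormal // trmxK (@bigmax_map_acos _ n) //.
    by rewrite ss; apply/minn_idPr.
  by have := spectral_norm_orthonormal_le1 SS QQ; rewrite trmxK.
have mpA : mpinv (Q *m T) = invmx T *m Q^T.
  by apply: mpinv_mulmx_unit; rewrite // trmx_mul trmxK.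
(* [A^+ Q = T^-1 Q^T Q = T^-1], and [Q] preserves lengths. *)
have normA x : sqnorm (invmx T *m x) <= spectral_norm (mpinv (Q *m T)) ^+ 2 * sqnorm x.
  rewrite -(sqnorm_isometry x QQ) (le_trans _ (sqnorm_mulmx_le _ _)) //.
  by rewrite mpA -mulmxA [Q^T *m _]mulmxA QQ mul1mx.
have [s_eq0|s_neq0] := eqVneq s 0; rewrite tanE.
  rewrite s_eq0 eqxx; split=> // p p1.
  (* If [A^+] had norm zero, [T^-1] would kill [T] applied to a basis vector. Hence the first
     product is [+oo], and [mule_def] then makes the residual norm nonzero. *)
  have specA0 : 0 < spectral_norm (mpinv (Q *m T)).
    rewrite lt0r spectral_norm_ge0 andbT; apply/eqP => A0.
    have := normA (T *m delta_mx 0 0); rewrite A0 expr0n mul0r mulKmx //.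
    by rewrite sqnorm_delta ler10.
  rewrite gt0_mulye ?lte_fin // /mule_def /= => R0.
  by rewrite gt0_mulye ?leey // lte_fin lt0r R0 schatten_norm_ge0.
have s_gt0 : 0 < s by rewrite lt0r s_neq0; case/andP: s01.
have normM := spectral_norm_sketch rowsS QQp1 s_gt0.
rewrite (negbTE s_neq0) -normM; split=> // p p1 _.
rewrite -!EFinM lee_fin.
have [V [W [_ WE WG mpN]]] := gram_inverse s_gt0.
set X := mpinv (S *m Q) in normM *.
have XN : X *m (S *m Q) = 1%:M by rewrite /X mpN -mulmxA.
have NXT : (S *m Q *m X)^T = S *m Q *m X.
  have WT : W^T = W by rewrite WE !trmx_mul trmxK tr_diag_mx mulmxA.
  rewrite /X mpN; move: (S *m Q) => N.
  by rewrite trmx_mul [(W *m _)^T]trmx_mul trmxK WT mulmxA.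
have mpSA : mpinv (S *m (Q *m T)) = invmx T *m X.
  by rewrite mulmxA; apply: mpinv_mulmx_unit.
apply: schatten_norm_le; rewrite ?mulr_ge0 ?spectral_norm_ge0 ?(leq_trans le_nc) //.
(* From [X S Q = 1] the difference is [T^-1 X S Rhat], and [Rhat = Qp Qp^T Rhat] because the
   residual is orthogonal to the columns of [Q]. *)
have diffE : Xtilde - Xhat = invmx T *m (X *m (S *m Qp) *m (Qp^T *m Rhat)).
  have RE : Rhat = B - Q *m (Q^T *m B).
    by rewrite /Rhat /Xhat mpA !mulmxA mulmxK.
  have QpR : Qp *m (Qp^T *m Rhat) = Rhat.
    have QpE : Qp *m Qp^T = 1%:M - Q *m Q^T by rewrite -QQp1 addrC addrA addNr add0r.
    rewrite mulmxA QpE mulmxBl mul1mx RE mulmxBr -!mulmxA [Q^T *m (Q *m _)]mulmxA.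
    by rewrite QQ mul1mx subrr subr0.
  rewrite -!mulmxA QpR /Xtilde /Xhat mpSA mpA -!mulmxA -mulmxBr; congr (_ *m _).
  by rewrite RE !mulmxBr [S *m (Q *m _)]mulmxA [X *m (S *m Q *m _)]mulmxA XN mul1mx.
have QpQp : orthonormal_cols Qp.
  have := QQp.1; rewrite /orthonormal_cols tr_row_mx mul_col_row scalar_mx_block.
  by move=> /eq_block_mx[].
(* The factors [T^-1], [K] and [Qp^T] are bounded in turn by [|A^+|], [|K|] and [1]. *)
move: (X *m (S *m Qp)) diffE => K diffE x; rewrite diffE -!mulmxA.
rewrite (le_trans (normA _)) // exprMn [_ ^+ 2 * _ ^+ 2]mulrC -[leRHS]mulrA.
rewrite ler_wpM2l ?sqr_ge0 // (le_trans (sqnorm_mulmx_le _ _)) //.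
by rewrite ler_wpM2l ?sqr_ge0 // sqnorm_trmx_le.
Qed.
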